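(* There exist a self-similar measure $\nu\in\mathcal P([0,1])$ and a $C^\infty$ diffeomorphism $h:[0,1]\to[0,1]$ such that: 1. both $\nu$ and $h_*\nu$ are not Rajchman; 2. $h'$ is constant on $\operatorname{supp}(\nu)$, and hence $h''|_{\operatorname{supp}(\nu)}=0$; 3. $h$ is not affine; in fact, $\inf_{\ell\ \mathrm{affine}}\|h-\ell\|_{C^1([0,1])}>0$.
   Context: $\mathcal P([0,1])$ is the set of Borel probability measures on $[0,1]$. A measure $\nu\in\mathcal P([0,1])$ is self-similar if there are finitely many affine maps $f_1,\dots,f_n:[0,1]\to[0,1]$ with $|f_i'|\in(0,1)$, not all sharing the same fixed point (standing assumption), and a strictly positive probability vector $(p_1,\dots,p_n)$ with $\nu=\sum_{i=1}^n p_i\cdot(f_i)_*\nu$. The Fourier transform is $\widehat\nu(\xi)=\int e^{-2\pi i\xi t}\,d\nu(t)$; $\nu$ is Rajchman if $\widehat\nu(\xi)\to0$ as $|\xi|\to\infty$. $\|f\|_{C^1([0,1])}=\sup_{[0,1]}|f|+\sup_{[0,1]}|f'|$, and the infimum is over all affine functions $\ell(x)=ax+b$, $a,b\in\mathbb R$. *)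

(* Defs.v *)
From mathcomp Require Import all_boot all_order all_algebra.
From mathcomp Require Import all_classical all_reals all_analysis.
From mathcomp.real_closed Require Import complex.

Set Implicit Arguments.
Unset Strict Implicit.
Unset Printing Implicit Defensive.
Import Order.TTheory GRing.Theory Num.Theory.
Import numFieldNormedType.Exports.
Local Open Scope classical_set_scope.
Local Open Scope ring_scope.

(* A map [0,1] -> [0,1] is represented by a function R -> R of which only the
   values on [0,1] matter, and an element of P([0,1]) by a Borel probability
   measure nu on R such that nu [0,1] = 1. *)
Definition I01 {R : realType} : set R := `[0, 1]%classic.

Definition self_similar (R : realType)
    (nu : probability (measurableTypeR R) R) : Prop :=
  exists (n : nat) (a b p : 'I_n -> R),
    let f (i : 'I_n) (x : measurableTypeR R) : measurableTypeR R :=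
      a i * x + b i in
    [/\ forall i, 0 < `|a i| < 1,
        forall i, {homo f i : x / I01 x >-> I01 x},
        ~ (exists x : R, forall i, f i x = x),
        (forall i, 0 < p i) /\ \sum_(i < n) p i = 1 &
        forall A : set (measurableTypeR R), measurable A ->
          nu A = (\sum_(i < n) (p i)%:E * pushforward nu (f i) A)%E].

Definition expi (R : realType) (theta : R) : R[i] :=
  Complex (cos theta) (sin theta).

Definition cintegral d (T : measurableType d) (R : realType)
    (mu : {measure set T -> \bar R}) (f : T -> R[i]) : R[i] :=
  Complex (\int[mu]_x complex.Re (f x)) (\int[mu]_x complex.Im (f x)).

Definition fourier (R : realType) (nu : probability (measurableTypeR R) R)
    (xi : R) : R[i] :=
  cintegral nu (fun t : R => expi (- (2 * pi * xi * t))).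

Definition rajchman (R : realType)
    (nu : probability (measurableTypeR R) R) : Prop :=
  forall eps : R, 0 < eps -> exists M : R, forall xi : R,
    M < `|xi| -> ComplexField.Normc.normc (fourier nu xi) < eps.

Definition supp (R : realType) (nu : probability (measurableTypeR R) R)
    : set R :=
  [set x | forall U : set R, open U -> U x -> (0 < nu U)%E].

(* Differentiation relative to A: the difference quotient only involves points
   of A, so that it yields the one-sided derivatives at the endpoints of an
   interval. *)
Definition dquot_in (R : realType) (A : set R) (f : R -> R) (x : R)
    : set_system R :=
  ((f y - f x) / (y - x)) @[y --> within A x^'].

Definition derivable_in (R : realType) (A : set R) (f : R -> R) (x : R) : Prop :=
  cvg (dquot_in A f x).

Definition derive_in (R : realType) (A : set R) (f : R -> R) (x : R) : R :=
  lim (dquot_in A f x).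

Definition smooth_in (R : realType) (A : set R) (f : R -> R) : Prop :=
  forall (n : nat) (x : R), A x -> derivable_in A (iter n (derive_in A) f) x.

Definition diffeo_in (R : realType) (A : set R) (h : R -> R) : Prop :=
  [/\ set_bij A A h, smooth_in A h &
      exists g : R -> R, smooth_in A g /\ forall x, A x -> g (h x) = x].

Definition C1norm (R : realType) (A : set R) (f : R -> R) : \bar R :=
  (ereal_sup [set `|f x|%R%:E | x in A] +
   ereal_sup [set `|derive_in A f x|%R%:E | x in A])%E.

(* Main.v *)
(** Let [nu] be the law of the Cantor function [G] under the uniform measure on
    [0,1], where [9 G(x) = digit x + G(doubling x)]. It is self-similar for
    [x/9] and [(x+1)/9] and lives on [0,1/8]. Modulo 1, [9^k G(x)] is
    [G(doubling^k x)], which lies in [0,1/8], so [cos(2 pi 9^k t)] is bounded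
    below by [cos(pi/4)] on the whole support and the Fourier transform of [nu]
    does not decay along the powers of 9. The same holds, along [9^k/s], for the
    image of [nu] by [x |-> s x].

    The diffeomorphism is [h(x) = s (x + e(x - 1/4))], where [e(u) = exp(-1/u)]
    for [u > 0] and [0] otherwise, and [s] is such that [h(1) = 1]. It is
    [x |-> s x] near the support, and [h' >= s > 0]. Its inverse [g] is smooth
    because [(F \o g)' = (F' / h') \o g]. As [h'] takes different values at 0
    and 1, [h] is not a C^1-limit of affine maps. *)

Require Import Defs.
From mathcomp Require Import all_boot all_order all_algebra.
From mathcomp Require Import all_classical all_reals all_analysis.
From mathcomp Require Import measurable_realfun ring lra.
From mathcomp.real_closed Require Import complex.
Import Order.TTheory GRing.Theory Num.Theory.
Import numFieldNormedType.Exports.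
Local Open Scope classical_set_scope.
Local Open Scope ring_scope.

(** * The Cantor function in base 9 *)

Section cantor_function.
Context {R : realType}.
Implicit Types x : R.

(** There is no reduction modulo 1: the bounds and the functional equation below then hold at every
    real. *)
Definition doubling x : R := if x < 2^-1 then 2 * x else 2 * x - 1.

Definition digit x : R := if x < 2^-1 then 0 else 1.

Fixpoint cantor_approx (n : nat) x : R :=
  if n is m.+1 then 9^-1 * (digit x + cantor_approx m (doubling x)) else 0.

Definition cantor_fun x : R := limn (cantor_approx ^~ x).

Lemma digit_itv x : 0 <= digit x <= 1.
Proof. by rewrite /digit; case: ifP; lra. Qed.

(** The upper bound is the fixed point of y |-> (1 + y)/9, so the recursion preserves it. *)
Lemma cantor_approx_itv n x : 0 <= cantor_approx n x <= 8^-1.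
Proof.
elim: n x => [|n IH] x /=; first by lra.
have := IH (doubling x); have := digit_itv x; lra.
Qed.

Lemma cantor_approxS n x : cantor_approx n x <= cantor_approx n.+1 x.
Proof.
elim: n x => [|n IH] x; first by case/andP: (cantor_approx_itv 1 x).
by rewrite [leLHS]/= [leRHS]/= ler_pM2l// lerD2l; exact: IH.
Qed.

Lemma is_cvg_cantor_approx x : cvgn (cantor_approx ^~ x).
Proof.
apply: nondecreasing_is_cvgn.
  by apply/nondecreasing_seqP => n; exact: cantor_approxS.
by exists 8^-1 => _ [n _ <-]; case/andP: (cantor_approx_itv n x).
Qed.

Lemma cantor_fun_itv x : 0 <= cantor_fun x <= 8^-1.
Proof.
apply/andP; split.
  apply: limr_ge; first exact: is_cvg_cantor_approx.
  by apply: nearW => n; case/andP: (cantor_approx_itv n x).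
apply: limr_le; first exact: is_cvg_cantor_approx.
by apply: nearW => n; case/andP: (cantor_approx_itv n x).
Qed.

Lemma cantor_funE x : cantor_fun x = 9^-1 * (digit x + cantor_fun (doubling x)).
Proof.
have cx := is_cvg_cantor_approx (doubling x).
apply: cvg_lim => //; rewrite -cvg_shiftS /=.
by apply: cvgM; [exact: cvg_cst | apply: cvgD; [exact: cvg_cst | exact: cx]].
Qed.

Lemma measurable_doubling : measurable_fun [set: R] doubling.
Proof.
apply: measurable_fun_ifT => //.
- exact: measurable_fun_ltr.
- by apply: measurable_funB => //; apply: measurable_funM.
Qed.

Lemma measurable_cantor_fun :
  @measurable_fun _ _ (measurableTypeR R) (measurableTypeR R) setT cantor_fun.
Proof.
apply: (measurable_fun_cvg (h := cantor_approx)) => [n|x _]; last first.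
  exact: is_cvg_cantor_approx.
elim: n => [|n IH] /=; first exact: measurable_cst.
apply: measurable_funM => //; apply: measurable_funD.
  by apply: measurable_fun_ifT => //; exact: measurable_fun_ltr.
by apply: measurableT_comp => //; exact: measurable_doubling.
Qed.

(** Here and in the next lemma, the inverse branches x/2 and x/2 + 1/2 of [doubling], with digits 0
    and 1, turn the functional equation into the contractions x/9 and (x + 1)/9. *)
Lemma cantor_fun_half x : x < 1 -> cantor_fun (2^-1 * x) = 9^-1 * cantor_fun x.
Proof.
move=> x1; rewrite cantor_funE /digit /doubling.
have -> : 2^-1 * x < 2^-1 by lra.
by rewrite add0r; congr (_ * cantor_fun _); lra.
Qed.

Lemma cantor_fun_halfD x : 0 <= x ->
  cantor_fun (2^-1 * x + 2^-1) = 9^-1 * cantor_fun x + 9^-1.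
Proof.
move=> x0; rewrite cantor_funE /digit /doubling.
have -> : 2^-1 * x + 2^-1 < 2^-1 = false by lra.
rewrite mulrDr mulr1 addrC; congr (_ * cantor_fun _ + _); lra.
Qed.

Lemma cos2piD1 x : cos (2 * pi * (x + 1)) = cos (2 * pi * x) :> R.
Proof. by rewrite mulrDr mulr1 (mulr_natl pi) cosD2pi. Qed.

Lemma cos2piDnat x k : cos (2 * pi * (x + k%:R)) = cos (2 * pi * x) :> R.
Proof.
elim: k => [|k IH]; first by rewrite addr0.
by rewrite -(addn1 k) natrD addrA cos2piD1.
Qed.

(* [9 * cantor_fun x] and [cantor_fun (doubling x)] are congruent modulo 1. *)
Lemma cos_cantor_fun k x :
  cos (2 * pi * (9 ^+ k * cantor_fun x)) =
  cos (2 * pi * cantor_fun (iter k doubling x)).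
Proof.
elim: k x => [|k IH] x; first by rewrite expr0 mul1r.
rewrite iterSr -IH [in LHS]cantor_funE.
set y := cantor_fun _.
have -> : 9 ^+ k.+1 * (9^-1 * (digit x + y)) = 9 ^+ k * y + 9 ^+ k * digit x.
  by rewrite exprSr; field.
rewrite /digit; case: ifP => _; first by rewrite mulr0 addr0.
by rewrite mulr1 -natrX cos2piDnat.
Qed.

Lemma cos_cantor_fun_ge k x :
  cos (pi / 4) <= cos (2 * pi * (9 ^+ k * cantor_fun x)).
Proof.
rewrite cos_cantor_fun; move: (iter _ _ _) => y.
have /andP[g0 g1] := cantor_fun_itv y; have p0 := pi_gt0 R.
(* The angle 2 pi y lies in [0, pi/4], and cos decreases on [0, pi]. *)
by rewrite leNgt ltr_cos ?in_itv/= -?leNgt; nra.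
Qed.

End cantor_function.

(** * The Cantor measure: self-similarity, support, Fourier transform *)

Section cantor_measure.
Context {R : realType}.

Lemma measurable_affine (c t : R) :
  measurable_fun [set: measurableTypeR R] (fun x => c * x + t : measurableTypeR R).
Proof. by apply: measurable_funD => //; exact: measurable_funM. Qed.

(** Lebesgue measure is determined by its values on the intervals ]u, v], where it agrees with c
    times its image under x |-> c x + t. *)
Lemma lebesgue_measure_affine (c t : R) (A : set (measurableTypeR R)) :
    0 < c -> measurable A ->
  lebesgue_measure A =
  (c%:E * lebesgue_measure ((fun x : R => c * x + t)%R @^-1` A))%E.
Proof.
move=> c0 mA; have c0' := ltW c0.
pose f : {mfun measurableTypeR R >-> measurableTypeR R} :=
  mfun_Sub (mem_set (measurable_affine c t)).
apply: (lebesgue_measure_unique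
  (mu := mscale (NngNum c0') (pushforward lebesgue_measure f))) => //.
move=> _ [[a b] _ <-] /=; rewrite /mscale/= /pushforward.
have -> : f @^-1` `]a, b] = `](a - t) / c, (b - t) / c]%classic.
  apply/seteqP; split => x /=; rewrite !in_itv/= ltr_pdivrMr// ler_pdivlMr//;
  lra.
rewrite !lebesgue_measure_itv/= !lte_fin ltr_pM2r ?invr_gt0// ltrD2r.
case: ifP => _; last by rewrite mule0.
by rewrite -!EFinD -EFinM; congr EFin; field; rewrite gt_eqF.
Qed.

(** The half-open interval splits into disjoint dyadic halves and keeps only points below 1, as
    [cantor_fun_half] requires. The endpoint removed is null. *)
Lemma uniform_prob01E (A : set (measurableTypeR R)) : measurable A ->
  uniform_prob (@ltr01 R) A = lebesgue_measure (A `&` `[0, 1[).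
Proof.
move=> mA; rewrite /uniform_prob integral_uniform_pdf.
transitivity (\int[lebesgue_measure]_(x in A `&` `[0%R, 1%R]) (cst 1 x : \bar R))%E.
  apply: eq_integral => x; rewrite inE /= in_itv/= => -[_ x01].
  by rewrite /uniform_pdf x01 subr0 invr1.
rewrite integral_cst ?mul1e//; last exact: measurableI.
apply/eqP; rewrite eq_le; apply/andP; split; last first.
  apply: le_measure; rewrite ?inE; try exact: measurableI.
  by apply: setIS => x /=; rewrite !in_itv/=; lra.
have <- : lebesgue_measure ((A `&` `[0, 1[) `|` [set 1%R]) =
  lebesgue_measure (A `&` `[(0:R), 1[).
  rewrite measureU0//; [exact: measurableI | exact: lebesgue_measure_set1].
apply: le_measure; rewrite ?inE; try exact: measurableI.
  by apply: measurableU => //; exact: measurableI.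
move=> x [Ax] /=; rewrite !in_itv/= => /andP[x0].
by rewrite le_eqVlt => /predU1P[->|x1]; [right | left; rewrite x0].
Qed.

Definition cantor_mfun : {mfun measurableTypeR R >-> measurableTypeR R} :=
  @mfun_Sub _ _ (measurableTypeR R) (measurableTypeR R) cantor_fun
    (mem_set measurable_cantor_fun).

Definition cantor_measure : probability (measurableTypeR R) R :=
  distribution (uniform_prob (@ltr01 R)) cantor_mfun.

Lemma cantor_measureT (A : set (measurableTypeR R)) :
  (forall x, A (cantor_fun x)) -> cantor_measure A = 1%E.
Proof.
move=> hA; rewrite -(@probability_setT _ _ _ (uniform_prob (@ltr01 R))).
by congr (uniform_prob _ _); apply/seteqP; split => x //= _; exact: hA.
Qed.

Lemma cantor_measure0 (A : set (measurableTypeR R)) :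
  (forall x, ~ A (cantor_fun x)) -> cantor_measure A = 0%E.
Proof.
move=> hA; rewrite -(@measure0 _ _ _ (uniform_prob (@ltr01 R))).
by congr (uniform_prob _ _); apply/seteqP; split => x //= /hA.
Qed.

Lemma cantor_measureE (A : set (measurableTypeR R)) : measurable A ->
  cantor_measure A =
  lebesgue_measure (cantor_fun @^-1` A `&` `[0, 1[ : set (measurableTypeR R)).
Proof.
move=> mA; rewrite -uniform_prob01E//; rewrite -[X in measurable X]setTI.
exact: measurable_cantor_fun.
Qed.

(** Split [0,1[ at 1/2 and rescale each half to [0,1[, which costs a factor 1/2. On each half
    [cantor_fun] becomes one of the two contractions applied to [cantor_fun]. *)
Lemma cantor_measure_self_similar (A : set (measurableTypeR R)) : measurable A ->
  cantor_measure A =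
  ((2^-1)%:E * cantor_measure ((fun x : R => 9^-1 * x)%R @^-1` A) +
   (2^-1)%:E * cantor_measure ((fun x : R => 9^-1 * x + 9^-1)%R @^-1` A))%E.
Proof.
move=> mA.
have maff (t : R) : measurable ((fun x : measurableTypeR R =>
    9^-1 * x + t : measurableTypeR R) @^-1` A).
  by rewrite -[X in measurable X]setTI; exact: measurable_affine.
have mgA : measurable (cantor_fun @^-1` A : set (measurableTypeR R)).
  by rewrite -[X in measurable X]setTI; exact: measurable_cantor_fun.
have m0 : measurable ((fun x : R => 9^-1 * x) @^-1` A : set (measurableTypeR R)).
  by have := maff 0; under eq_fun do rewrite addr0.
rewrite !cantor_measureE//.
pose B : set (measurableTypeR R) := cantor_fun @^-1` A.
have -> : lebesgue_measure (B `&` `[0, 1[) =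
    (lebesgue_measure (B `&` `[0%R, 2^-1%R[) +
     lebesgue_measure (B `&` `[2^-1%R, 1%R[))%E.
  rewrite -measureU; [|exact: measurableI|exact: measurableI|]; last first.
    by apply/seteqP; split => x //= [[_] + [_]]; rewrite !in_itv/=; lra.
  congr (lebesgue_measure _); rewrite -setIUr; congr (_ `&` _).
  by apply/seteqP; split => x /=; rewrite !in_itv/=; lra.
have half0 : (0 : R) < 2^-1 by lra.
rewrite (lebesgue_measure_affine _ 0 (B `&` `[0, _[) half0); last first.
  exact: measurableI.
rewrite (lebesgue_measure_affine _ 2^-1 (B `&` `[2^-1, _[) half0); last first.
  exact: measurableI.
congr (_ * lebesgue_measure _ + _ * lebesgue_measure _)%E;
  apply/seteqP; split => x /=; rewrite !in_itv/=.
- rewrite addr0 /B/= => -[Ax xI]; rewrite -cantor_fun_half; last by lra.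
  by split => //; lra.
- by move=> [Ax xI]; rewrite addr0 /B/= cantor_fun_half; [split => //; lra | lra].
- rewrite /B/= => -[Ax xI]; rewrite -cantor_fun_halfD; last by lra.
  by split => //; lra.
- by move=> [Ax xI]; rewrite /B/= cantor_fun_halfD; [split => //; lra | lra].
Qed.

Lemma self_similar_cantor_measure : self_similar cantor_measure.
Proof.
exists 2%N, (fun=> 9^-1), (fun i => if i == ord0 then 0 else 9^-1), (fun=> 2^-1).
split.
- by move=> _; rewrite ger0_norm; lra.
- move=> i x; rewrite /I01 /= !in_itv/=; case: ifP => _; lra.
(* The two maps have fixed points 0 and 1/8. *)
- by move=> [x fx]; have := fx ord0; have := fx ord_max => /=; lra.
- by split => [_|]; rewrite ?big_ord_recl ?big_ord0; lra.
- move=> A mA; rewrite cantor_measure_self_similar// big_ord_recl big_ord1/=.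
  congr (_ * cantor_measure _ + _)%E.
  by apply/seteqP; split => x /=; rewrite addr0.
Qed.

(** The open half-lines on either side of [0, 1/8] miss the range of [cantor_fun], hence are
    null. *)
Lemma supp_cantor_measure (x : R) : supp cantor_measure x -> 0 <= x <= 8^-1.
Proof.
move=> sx; rewrite leNgt [x <= _]leNgt -negb_or; apply/negP => nx.
suff [U [oU Ux U0]] : exists U : set R,
    [/\ open U, U x & cantor_measure U = 0%E].
  by have := sx _ oU Ux; rewrite U0 ltxx.
case/orP: nx => nx.
- exists `]-oo, 0[%classic; split; rewrite /= ?in_itv//=.
  apply: cantor_measure0 => y /=; rewrite in_itv/=.
  by have := cantor_fun_itv y; lra.
- exists `]8^-1, +oo[%classic; split; rewrite /= ?in_itv/= ?andbT//.
  apply: cantor_measure0 => y /=; rewrite in_itv/=.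
  by have := cantor_fun_itv y; lra.
Qed.

(** The real part of the Fourier transform at xi is the integral of cos(2 pi xi t). It is at least c
    when the cosine is at least c almost surely, and it bounds the modulus from below. *)
Lemma not_rajchmanP (mu : probability (measurableTypeR R) R) (c : R) : 0 < c ->
  (forall M : R, exists2 xi : R, M < `|xi| &
    mu [set t : R | c <= cos (2 * pi * xi * t)] = 1%E) ->
  ~ rajchman mu.
Proof.
move=> c0 hmu /(_ c c0)[M hM]; have [xi Mxi muS] := hmu M.
have := hM xi Mxi; apply/negP; rewrite -leNgt.
pose f (t : measurableTypeR R) : R := cos (2 * pi * xi * t).
pose S : set (measurableTypeR R) := [set t | c <= f t].
have mf : measurable_fun [set: measurableTypeR R] f.
  apply: measurableT_comp; last exact: measurable_funM.
  by apply: continuous_measurable_fun; exact: continuous_cos.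
have mS : measurable S.
  rewrite (_ : S = [set: _] `&` f @^-1` `[c, +oo[); first exact: mf.
  by apply/seteqP; split => x /=; rewrite in_itv/= andbT// => -[].
have intf : mu.-integrable [set: _] (EFin \o f).
  apply: measurable_bounded_integrable => //.
    by rewrite [ltLHS]probability_setT ltry.
  exists 1; split => // y y1 t _ /=.
  by rewrite (le_trans _ (ltW y1))// ler_norml cos_geN1 cos_le1.
suff : c <= complex.Re (fourier mu xi).
  move=> /le_trans; apply; case: (fourier mu xi) => a b /=.
  rewrite (le_trans (ler_norm a))// -sqrtr_sqr ler_wsqrtr// lerDl.
  exact: sqr_ge0.
rewrite /fourier /cintegral/=.
under eq_Rintegral do rewrite cosN.
suff : c <= \int[mu]_x f x by [].
(* As S has measure 1, c is the integral over S of the constant c. *)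
rewrite -[leLHS]mulr1 -[1]/(fine 1) -muS -/S -Rintegral_cst//.
have -> : \int[mu]_x f x = \int[mu]_(x in S) f x.
  rewrite /Rintegral (negligible_integral (N := ~` S))//=; last 2 first.
  - exact: measurableC.
  - by rewrite probability_setC// [X in (_ - X)%E]muS subee.
  by rewrite setDE setCK setTI.
apply: le_Rintegral => //.
- apply: measurable_bounded_integrable => //; last exact: bounded_cst.
  by rewrite [ltLHS]muS ltry.
- exact: integrableS intf.
Qed.

End cantor_measure.

(** * Smoothness on the line and derivatives relative to [0,1] *)

Section smooth.
Context {R : realType}.
Implicit Types (x l : R) (f F : R -> R).

(** The successive derivatives are given as explicit two-sided ones, with which the iterated
    relative derivatives on [0,1] are then identified. *)
Definition smooth f : Prop := exists D : nat -> R -> R,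
  D 0%N = f /\ forall n x, is_derive x 1 (D n) (D n.+1 x).

(** Choice turns the closure property into an operator [d], whose iterates are the successive
    derivatives. No formula for the n-th derivative has to be found. *)
Lemma derive_stable_smooth (P : set (R -> R)) :
    (forall f, P f -> exists2 f', P f' & forall x, is_derive x 1 f (f' x)) ->
  forall f, P f -> smooth f.
Proof.
move=> Pd f Pf.
have /choice[d dP] : forall f, exists f', P f ->
    P f' /\ forall x, is_derive x 1 f (f' x).
  move=> u; have [/Pd[u' Pu' uu']|nPu] := pselect (P u); first by exists u'.
  by exists u.
have PD n : P (iter n d f) by elim: n => //= n /dP[].
by exists (fun n => iter n d f); split => // n x; have [_] := dP _ (PD n); apply.
Qed.

(** This makes limits of relative difference quotients unique. Points of [0,1] approach x from the
    right if x < 1/2 and from the left otherwise; a step of at most 1/2 stays inside. *)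
Lemma within_I01_dnbhs_proper x : I01 x -> ProperFilter (within I01 x^').
Proof.
rewrite /I01/= in_itv/= => x01; apply: Build_ProperFilter_ex => P.
move=> /nbhs_ballP[e /= e0 xeP].
pose d := Num.min (e / 2) 2^-1.
have d0 : 0 < d by rewrite /d lt_min; lra.
have de : d <= e / 2 by rewrite /d ge_min lexx.
have d2 : d <= 2^-1 by rewrite /d ge_min lexx orbT.
have [x2|x2] := ltP x 2^-1.
- exists (x + d); apply: xeP; rewrite /I01 /ball/= ?in_itv/=; [|lra..].
  by rewrite opprD addNKr normrN gtr0_norm//; lra.
- exists (x - d); apply: xeP; rewrite /I01 /ball/= ?in_itv/=; [|lra..].
  by rewrite opprB addrC subrK gtr0_norm//; lra.
Qed.

(** Off x, the difference quotient is the Caratheodory slope of F, which is continuous at x.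
    Agreement on [0,1] alone is assumed because that is all an iterated [derive_in] offers in the
    induction of [smooth_smooth_in]. *)
Lemma dquot_in_cvg f F x l : I01 x -> {in I01, f =1 F} ->
  is_derive x 1 F l -> dquot_in I01 f x --> l.
Proof.
move=> Ix fF /is_derive1_caratheodory[g [gE cg <-]].
have : g @ within I01 x^' --> g x.
  by apply: cvg_within_filter; apply: cvg_within_filter; exact: cg.
apply: cvg_trans; apply: near_eq_cvg; rewrite !near_withinE; apply: nearW => y yx Iy.
by rewrite !fF ?inE// gE mulfK// subr_eq0.
Qed.

Lemma derive_inE f F x l : I01 x -> {in I01, f =1 F} ->
  is_derive x 1 F l -> derive_in I01 f x = l.
Proof.
move=> Ix fF dF; have ? := within_I01_dnbhs_proper _ Ix.
by apply: cvg_lim => //; exact: dquot_in_cvg dF.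
Qed.

Lemma smooth_smooth_in f : smooth f -> smooth_in I01 f.
Proof.
move=> [D [D0 DS]].
have DE n : {in I01, iter n (derive_in I01) f =1 D n}.
  elim: n => [|n IH] x; rewrite inE => Ix /=; first by rewrite D0.
  exact: derive_inE IH (DS n x).
move=> n x Ix; apply/cvg_ex; exists (D n.+1 x).
exact: dquot_in_cvg (DE n) (DS n x).
Qed.

End smooth.

(** * Functions flat at the origin *)

Section flat.
Context {R : realType}.
Implicit Types u v x : R.

(** Powers of 1/u are included so that the linear span of the family is closed under
    differentiation. *)
Definition flat (n : nat) u : R :=
  if 0 < u then expR (- u^-1) * u^-1 ^+ n else 0.

Lemma flat_le0 n u : u <= 0 -> flat n u = 0.
Proof. by rewrite /flat leNgt => /negbTE ->. Qed.

Lemma flat_ge0 n u : 0 <= flat n u.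
Proof.
rewrite /flat; case: ifP => // u0.
by rewrite mulr_ge0 ?expR_ge0// exprn_ge0// invr_ge0 ltW.
Qed.

Lemma flat_gt0 n u : 0 < u -> 0 < flat n u.
Proof. by move=> u0; rewrite /flat u0 mulr_gt0 ?expR_gt0// exprn_gt0 ?invr_gt0. Qed.

Lemma flat0_nondecreasing u v : u <= v -> flat 0 u <= flat 0 v.
Proof.
move=> uv; have [u0|u0] := leP u 0; first by rewrite flat_le0// flat_ge0.
have v0 := lt_le_trans u0 uv.
by rewrite /flat u0 v0 !expr0 !mulr1 ler_expR lerN2 lef_pV2.
Qed.

(** With v = 1/u, a single term of the exponential series gives v^(n+2) <= (n+2)! exp(v). The
    quadratic bound forces decay at 0. *)
Lemma flat_le_sqr n u : flat n u <= n.+2`!%:R * u ^+ 2.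
Proof.
have [u0|u0] := leP u 0; first by rewrite flat_le0// mulr_ge0 ?sqr_ge0.
have uV0 : 0 < u^-1 by rewrite invr_gt0.
rewrite /flat u0 expRN mulrC ler_pdivrMr ?expR_gt0//.
have : u^-1 ^+ n.+2 / n.+2`!%:R <= expR u^-1.
  apply: le_trans (expR_ge1Dxn n.+1 (ltW uV0)); rewrite lerDr ler01 //.
have f0 : 0 < n.+2`!%:R :> R by rewrite ltr0n fact_gt0.
rewrite ler_pdivrMr// => H.
have -> : u^-1 ^+ n = u ^+ 2 * u^-1 ^+ n.+2.
  by rewrite !exprSr; field; rewrite gt_eqF.
nra.
Qed.

Lemma is_derive_flat n u :
  is_derive u 1 (flat n) (flat n.+2 u - n%:R * flat n.+1 u).
Proof.
have [u0|u0|->] := ltrgt0P u.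
- have nE : {near u, (fun v => expR (- v^-1) * v^-1 ^+ n) =1 flat n}.
    by near=> v; rewrite /flat; have -> : 0 < v by near: v; exact: lt_nbhsr.
  apply: near_eq_is_derive nE _ => //.
  have un0 : u != 0 by rewrite gt_eqF.
  have dV : is_derive u 1 (fun v : R => v^-1) (- u^-1 ^+ 2).
    have := is_deriveV un0 (is_derive_id u 1).
    by rewrite /GRing.scale/= mulr1 exprVn.
  have dE : is_derive u 1 (expR \o (fun v : R => - v^-1))
      (u^-1 ^+ 2 * expR (- u^-1)).
    have dN := is_deriveN dV; rewrite opprK in dN.
    have dx := is_derive_expR (- u^-1).
    by rewrite mulrC; exact: (is_derive1_comp (f := expR)). 
  have := is_deriveM dE (is_deriveX n dV).
  rewrite /GRing.scale/=.
  have -> : flat n.+2 u - n%:R * flat n.+1 u =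
    expR (- u^-1) * (n%:R * u^-1 ^+ n.-1 * - u^-1 ^+ 2) +
      (u^-1) ^+ n * (u^-1 ^+ 2 * expR (- u^-1)).
    (* The case n = 0 is separate because of [n.-1]; its coefficient vanishes there. *)
    rewrite /flat u0; case: (n) => [|m] /=; rewrite !exprS; ring.
  by congr is_derive; rewrite exprfctE.
- have nE : {near u, cst 0 =1 flat n}.
    near=> v; rewrite flat_le0//; apply: ltW; near: v; exact: lt_nbhsl.
  rewrite !(flat_le0 _ u) ?ltW// mulr0 subr0.
  by apply: near_eq_is_derive nE _.
- rewrite !(flat_le0 _ 0)// mulr0 subr0.
  (* As [flat n z] is [flat n.+1 z * z], the slope at 0 is [flat n.+1], continuous there by the
     quadratic bound. *)
  apply/is_derive1_caratheodory; exists (flat n.+1); split; last exact: flat_le0.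
    move=> z; rewrite (flat_le0 _ 0)// !subr0.
    have [z0|z0] := leP z 0; first by rewrite !flat_le0// mul0r.
    by rewrite /flat z0 exprSr !mulrA mulfVK// gt_eqF.
  rewrite /prop_for /continuous_at flat_le0//.
  apply: (squeeze_cvgr (f := cst 0) (h := fun z => n.+3`!%:R * z ^+ 2)).
  - by apply: nearW => z; rewrite flat_ge0 flat_le_sqr.
  - exact: cvg_cst.
  - rewrite -[X in _ --> X](mulr0 n.+3`!%:R).
    apply: cvgM; first exact: cvg_cst.
    have : (fun z : R => z ^+ 2) z @[z --> 0] --> (0 : R) ^+ 2.
      exact: exprn_continuous.
    by rewrite expr0n.
Unshelve. all: by end_near.
Qed.

End flat.

(** * The diffeomorphism, its inverse and its distance to affine maps *)

Section bend.
Context {R : realType}.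
Implicit Types x y : R.

Definition bend_scale : R := (1 + flat 0 (3 / 4))^-1.

(** The bend starts at 1/4, strictly beyond 1/8, so that the map is linear on a neighbourhood of the
    support. *)
Definition bend x : R := bend_scale * (x + flat 0 (x - 4^-1)).

Definition bend_slope x : R := bend_scale * (1 + flat 2 (x - 4^-1)).

Lemma bend_scale_gt0 : 0 < bend_scale.
Proof. by rewrite invr_gt0 ltr_wpDr// flat_ge0. Qed.

Lemma bend_slope_gt0 x : 0 < bend_slope x.
Proof. by rewrite mulr_gt0 ?bend_scale_gt0// ltr_wpDr// flat_ge0. Qed.

Lemma bend_le4V x : x <= 4^-1 -> bend x = bend_scale * x.
Proof. by move=> x4; rewrite /bend flat_le0 ?addr0//; lra. Qed.

Lemma bend_slope_le4V x : x <= 4^-1 -> bend_slope x = bend_scale.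
Proof. by move=> x4; rewrite /bend_slope flat_le0 ?addr0 ?mulr1//; lra. Qed.

Lemma bend0 : bend 0 = 0.
Proof. by rewrite bend_le4V ?mulr0//; lra. Qed.

Lemma bend1 : bend 1 = 1.
Proof.
rewrite /bend (_ : 1 - 4^-1 = 3 / 4); last by lra.
by rewrite mulVf// gt_eqF// ltr_wpDr// flat_ge0.
Qed.

(** The term in [flat 0] is nondecreasing, so it can only enlarge increments. Strict monotonicity
    follows. *)
Lemma bend_expand x y : x <= y -> bend_scale * (y - x) <= bend y - bend x.
Proof.
move=> xy; rewrite /bend -mulrBr ler_pM2l ?bend_scale_gt0//.
have : flat 0 (x - 4^-1) <= flat 0 (y - 4^-1) by apply: flat0_nondecreasing; lra.
lra.
Qed.

Lemma bend_mono : {mono bend : x y / x <= y}.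
Proof.
apply: le_mono => x y xy; have := bend_expand _ _ (ltW xy).
by rewrite -subr_gt0; apply: lt_le_trans; rewrite mulr_gt0 ?bend_scale_gt0 ?subr_gt0.
Qed.

Lemma is_derive_flat_shift n x : is_derive x 1 (fun y : R => flat n (y - 4^-1))
  (flat n.+2 (x - 4^-1) - n%:R * flat n.+1 (x - 4^-1)).
Proof.
have dS : is_derive x 1 (fun y : R => y - 4^-1) 1.
  have := is_deriveD (is_derive_id x 1) (is_derive_cst (- 4^-1 : R) x 1).
  by rewrite addr0.
have := is_derive1_comp (g := fun y => y - 4^-1) (is_derive_flat n (x - 4^-1)) dS.
by rewrite mulr1.
Qed.

Lemma is_derive_bend x : is_derive x 1 bend (bend_slope x).
Proof.
have := is_deriveD (is_derive_id x 1) (is_derive_flat_shift 0 x).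
by rewrite mul0r subr0 => /(is_deriveZ bend_scale).
Qed.

Lemma continuous_bend : continuous bend.
Proof.
by move=> x; apply/differentiable_continuous/derivable1_diffP; case: (is_derive_bend x).
Qed.

(** Being onto the whole line makes the inverse global, so its derivatives are two-sided even at 0
    and 1. For y > 0, the intermediate value theorem applies on [0, y/s] since h(y/s) >= y. *)
Lemma bend_surj y : exists x, bend x = y.
Proof.
have s0 := bend_scale_gt0; have sE : bend_scale * (y / bend_scale) = y.
  by rewrite mulrC mulfVK// gt_eqF.
have [y0|y0] := leP y 0.
  exists (y / bend_scale); rewrite bend_le4V// (@le_trans _ _ 0)//.
  by rewrite ler_pdivrMr// mul0r.
have yb : 0 <= y / bend_scale by rewrite divr_ge0// ltW.
have yle : y <= bend (y / bend_scale).
  by rewrite -[leLHS]sE ler_pM2l// lerDl flat_ge0.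
have [|x _ <-] := IVT (f := bend) (v := y) yb (continuous_subspaceT continuous_bend).
  by rewrite bend0 ge_min le_max (ltW y0) yle orbT.
by exists x.
Qed.

Definition bend_inv y : R := xget 0 [set x | bend x = y].

Lemma bend_invK y : bend (bend_inv y) = y.
Proof.
have [x xy] := bend_surj y.
exact: (@xgetPex _ 0 [set x | bend x = y] (ex_intro _ x xy)).
Qed.

Lemma bendK x : bend_inv (bend x) = x.
Proof. exact: (inc_inj bend_mono (bend_invK _)). Qed.

Lemma is_derive_bend_inv y : is_derive y 1 bend_inv (bend_slope (bend_inv y))^-1.
Proof.
rewrite -{1}(bend_invK y); apply: is_derive_inverse.
- by near=> x; exact: bendK.
- by near=> x; exact: continuous_bend.
- exact: is_derive_bend.
- by rewrite gt_eqF// bend_slope_gt0.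
Unshelve. all: by end_near. Qed.

(* An algebra stable under differentiation, in which both [bend] and all the
   [F] such that [F \o bend_inv] is an iterated derivative of [bend_inv] live. *)
Inductive bend_alg : (R -> R) -> Prop :=
| bend_alg_cst c : bend_alg (fun=> c)
| bend_alg_id : bend_alg id
| bend_alg_flat n : bend_alg (fun x => flat n (x - 4^-1))
| bend_alg_add f g : bend_alg f -> bend_alg g -> bend_alg (fun x => f x + g x)
| bend_alg_mul f g : bend_alg f -> bend_alg g -> bend_alg (fun x => f x * g x)
| bend_alg_inv : bend_alg (fun x => (bend_slope x)^-1).

Lemma bend_alg_derive f : bend_alg f ->
  exists2 f', bend_alg f' & forall x, is_derive x 1 f (f' x).
Proof.
have flat' n : bend_alg (fun x => flat n.+2 (x - 4^-1) + - n%:R * flat n.+1 (x - 4^-1)).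
  apply: bend_alg_add; first exact: bend_alg_flat.
  by apply: bend_alg_mul; [exact: bend_alg_cst | exact: bend_alg_flat].
elim => {f} [c||n|f g _ [f' af' ff'] _ [g' ag' gg']|
    f g af [f' af' ff'] ag [g' ag' gg']|].
- by exists (fun=> 0); [exact: bend_alg_cst | move=> x; exact: is_derive_cst].
- by exists (fun=> 1); [exact: bend_alg_cst | move=> x; exact: is_derive_id].
- exists (fun x => flat n.+2 (x - 4^-1) + - n%:R * flat n.+1 (x - 4^-1)) => // x.
  by rewrite mulNr; exact: is_derive_flat_shift.
- exists (fun x => f' x + g' x); first exact: bend_alg_add.
  by move=> x; exact: is_deriveD.
- exists (fun x => f x * g' x + g x * f' x).
    by apply: bend_alg_add; exact: bend_alg_mul.
  by move=> x; exact: is_deriveM.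
(* The derivative of 1/h' is - h''/h'^2, where h'' is [bend_scale * s' x]. *)
- pose v x := (bend_slope x)^-1.
  pose s' x := flat 4 (x - 4^-1) + - 2 * flat 3 (x - 4^-1).
  exists (fun x => - bend_scale * (v x * v x) * s' x).
    apply: bend_alg_mul; last exact: (flat' 2).
    apply: bend_alg_mul; first exact: bend_alg_cst.
    by apply: bend_alg_mul; exact: bend_alg_inv.
  move=> x; have s0 : bend_slope x != 0 by rewrite gt_eqF// bend_slope_gt0.
  have dS : is_derive x 1 bend_slope (bend_scale * s' x).
    have := is_deriveD (is_derive_cst (1 : R) x 1) (is_derive_flat_shift 2 x).
    by rewrite add0r -mulNr => /(is_deriveZ bend_scale).
  have := is_deriveV s0 dS; congr is_derive.
  by rewrite /GRing.scale/= /v expr2 invfM; ring.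
Qed.

Lemma smooth_bend : smooth bend.
Proof.
apply: (derive_stable_smooth _ bend_alg_derive).
apply: bend_alg_mul; first exact: bend_alg_cst.
by apply: bend_alg_add; [exact: bend_alg_id | exact: bend_alg_flat].
Qed.

Lemma smooth_bend_inv : smooth bend_inv.
Proof.
pose P f := exists2 F, bend_alg F & f = F \o bend_inv.
apply: (derive_stable_smooth P); last by exists id => //; exact: bend_alg_id.
move=> _ [F aF ->]; have [F' aF' FF'] := bend_alg_derive _ aF.
exists ((fun x => F' x * (bend_slope x)^-1) \o bend_inv).
  by eexists; [exact: bend_alg_mul aF' bend_alg_inv|].
by move=> x; apply: is_derive1_comp; exact: is_derive_bend_inv.
Qed.

Lemma diffeo_bend : diffeo_in I01 bend.
Proof.
split; last 2 first.
- exact: smooth_smooth_in smooth_bend.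
- by exists bend_inv; split => [|x _]; [exact: smooth_smooth_in smooth_bend_inv|exact: bendK].
split.
- move=> x; rewrite /I01/= !in_itv/=.
  by have := bend_mono 0 x; have := bend_mono x 1; rewrite bend0 bend1 => -> ->.
- by move=> x y _ _; exact: (inc_inj bend_mono).
- move=> y; rewrite /I01/= in_itv/= => y01.
  exists (bend_inv y); last exact: bend_invK.
  have := bend_mono 0 (bend_inv y); have := bend_mono (bend_inv y) 1.
  by rewrite bend0 bend1 bend_invK in_itv/= => <- <-.
Qed.

Lemma derive_in_bend x : I01 x -> derive_in I01 bend x = bend_slope x.
Proof. by move=> Ix; exact: derive_inE (is_derive_bend x). Qed.

(** The slope is constant on ]-oo, 1/4[, a neighbourhood of x. *)
Lemma derive_in2_bend x : I01 x -> x <= 8^-1 ->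
  derive_in I01 (derive_in I01 bend) x = 0.
Proof.
move=> Ix x8; apply: (derive_inE _ bend_slope) => //.
  by move=> y; rewrite inE; exact: derive_in_bend.
apply: (near_eq_is_derive (f := cst bend_scale)).
near=> y; rewrite bend_slope_le4V//; apply: ltW; near: y.
by apply: lt_nbhsl; lra.
Unshelve. all: by end_near. Qed.

(** The values at 0 and 1/4 force b = 0 and a = s; the value at 1 then contradicts the positivity of
    [flat 0] at 3/4. *)
Lemma bend_not_affine : ~ exists a b : R, forall x, I01 x -> bend x = a * x + b.
Proof.
move=> [a [b ab]].
have I x : 0 <= x <= 1 -> bend x = a * x + b.
  by move=> x01; apply: ab; rewrite /I01/= in_itv.
have := I 0; rewrite bend0 => /(_ ltac:(lra)) b0.
have := I 4^-1; rewrite bend_le4V// => /(_ ltac:(lra)) a4.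
have := I 1; rewrite /bend => /(_ ltac:(lra)).
have s0 := bend_scale_gt0.
have f0 : 0 < flat 0 (1 - 4^-1 : R) by apply: flat_gt0; lra.
nra.
Qed.

(** The slopes at 0 and 1 differ by s times [flat 2 (3 / 4)], so at least one of them is half that
    far from a. The supremum of |f| only contributes a nonnegative term. *)
Lemma C1norm_bend_sub_affine (a b : R) :
  ((bend_scale * flat 2 (3 / 4) / 2)%:E <=
   C1norm I01 (fun x => bend x - (a * x + b))%R)%E.
Proof.
set f := fun x => _.
have I0 : I01 (0 : R) by rewrite /I01/= in_itv/=; lra.
have I1 : I01 (1 : R) by rewrite /I01/= in_itv/=; lra.
have df x : I01 x -> derive_in I01 f x = bend_slope x - a.
  move=> Ix; apply: (derive_inE _ f) => //.
  have dx : is_derive x 1 (fun y : R => a * y + b) a.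
    have := is_deriveD (is_deriveZ a (is_derive_id x 1)) (is_derive_cst b x 1).
    by rewrite addr0 /GRing.scale/= mulr1.
  exact: is_deriveB (is_derive_bend x) dx.
rewrite -[leLHS]add0e; apply: leeD.
  apply: le_trans (ereal_sup_ubound _); last by exists 0.
  by rewrite lee_fin.
have sE x : I01 x -> (`|bend_slope x - a|%:E <=
    ereal_sup [set `|derive_in I01 f x|%R%:E | x in I01])%E.
  by move=> Ix; apply: ereal_sup_ubound; exists x => //; rewrite df.
have [|] := leP (bend_scale * flat 2 (3 / 4) / 2) `|bend_slope 1 - a|.
  by rewrite -lee_fin => /le_trans; apply; exact: sE.
move=> h1; apply: le_trans (sE 0 I0); rewrite lee_fin.
have : bend_slope 1 - bend_slope 0 = bend_scale * flat 2 (3 / 4).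
  rewrite (bend_slope_le4V 0); last by lra.
  by rewrite /bend_slope (_ : 1 - 4^-1 = 3 / 4); [ring | lra].
have := ler_normB (bend_slope 1 - a) (bend_slope 0 - a).
rewrite opprB addrA subrK.
have := ler_norm (bend_slope 1 - bend_slope 0).
by move: h1; lra.
Qed.

End bend.

(** * Assembling the example *)

Section example.
Context {R : realType}.

(** Serves both measures: s = 1 for the Cantor measure, s = [bend_scale] for its image. At frequency
    9^k/s the dilation cancels. *)
Lemma dilated_cantor_not_rajchman (s : R)
    (mu : probability (measurableTypeR R) R) : 0 < s ->
    (forall A, (forall x, A (s * cantor_fun x)) -> mu A = 1%E) ->
  ~ rajchman mu.
Proof.
move=> s0 muA; apply: (not_rajchmanP mu (cos (pi / 4))).
  by apply: cos_gt0_pihalf; have := pi_gt0 R; lra.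
(* This k gives M s < 2^k <= 9^k. *)
move=> M; pose k := Num.bound (M * s).
have Mk : M * s < 9 ^+ k.
  by rewrite (lt_le_trans (upper_nthrootP (leqnn k)))// lerXn2r ?nnegrE; lra.
exists (9 ^+ k / s).
  by rewrite (lt_le_trans _ (ler_norm _))// ltr_pdivlMr.
apply: muA => x /=.
have -> : 2 * pi * (9 ^+ k / s) * (s * cantor_fun x) =
    2 * pi * (9 ^+ k * cantor_fun x).
  by field; rewrite gt_eqF.
exact: cos_cantor_fun_ge.
Qed.

Lemma measurable_bend :
  @measurable_fun _ _ (measurableTypeR R) (measurableTypeR R) setT bend.
Proof. by apply: continuous_measurable_fun; exact: continuous_bend. Qed.

Definition bend_mfun : {mfun measurableTypeR R >-> measurableTypeR R} :=
  @mfun_Sub _ _ (measurableTypeR R) (measurableTypeR R) bend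
    (mem_set measurable_bend).

End example.

Theorem proposition11 (R : realType) :
  exists (nu : probability (measurableTypeR R) R)
         (h : {mfun measurableTypeR R >-> measurableTypeR R}),
    [/\ nu I01 = 1%E, self_similar nu & diffeo_in I01 h] /\
    [/\ ~ rajchman nu /\ ~ rajchman (distribution nu h),
        (exists c : R, forall x : R, supp nu x -> derive_in I01 h x = c) /\
        (forall x : R, supp nu x -> derive_in I01 (derive_in I01 h) x = 0),
        ~ (exists a b : R, forall x : R, I01 x -> (h x : R) = a * x + b) &
        (0 < ereal_inf
               [set C1norm I01 (fun x : R => (h x : R) - (ab.1 * x + ab.2))%R
               | ab in [set: R * R]])%E].
Proof.
have suppI (x : R) : supp cantor_measure x -> I01 x /\ x <= 8^-1.
  by move=> /supp_cantor_measure; rewrite /I01/= in_itv/=; lra.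
exists cantor_measure, bend_mfun; split; split.
- apply: cantor_measureT => x; rewrite /I01/= in_itv/=.
  by have := cantor_fun_itv x; lra.
- exact: self_similar_cantor_measure.
- exact: diffeo_bend.
- split.
    apply: (dilated_cantor_not_rajchman 1) => // A hA.
    by apply: cantor_measureT => x; have := hA x; rewrite mul1r.
  (* All values of [cantor_fun] are at most 1/8, where [bend] is multiplication by [bend_scale]. *)
  apply: (dilated_cantor_not_rajchman bend_scale).
    exact: bend_scale_gt0.
  move=> A hA; apply: cantor_measureT => x /=.
  by rewrite bend_le4V //; have := cantor_fun_itv x; lra.
- split.
    exists bend_scale => x /suppI[Ix x8].
    by rewrite (derive_in_bend _ Ix) bend_slope_le4V//; lra.
  by move=> x /suppI[Ix x8]; exact: derive_in2_bend.
- exact: bend_not_affine.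
(* The lower bound is uniform in a and b, so it passes to the infimum. *)
- apply: (@lt_le_trans _ _ (bend_scale * flat 2 (3 / 4) / 2)%:E).
    rewrite lte_fin divr_gt0// mulr_gt0 ?bend_scale_gt0//.
    by apply: flat_gt0; lra.
  apply: le_ereal_inf_tmp => _ [[a b] _ <-].
  exact: C1norm_bend_sub_affine.
Qed.
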